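(* For every $\varepsilon \in (0,1)$ there exists $t_0=t_0(\varepsilon)$ such that for every integer $t \ge t_0$ there exists a graph $G$ which does not contain $K_t$ as a minor and whose list chromatic number satisfies $\chi_\ell(G) \ge (2-\varepsilon)t$.
   Context: All graphs are finite and simple. A graph $G$ contains $K_t$ as a minor if it has a subgraph whose vertex set can be partitioned into $t$ pairwise disjoint non-empty sets $Z_1,\ldots,Z_t$ such that each induced subgraph $G[Z_i]$ is connected and for every two distinct $i,j$ there is an edge of $G$ between $Z_i$ and $Z_j$. A list assignment $L$ assigns a finite set $L(v)\subseteq \mathbb{N}$ to each vertex $v$; an $L$-coloring is a proper coloring $c$ with $c(v)\in L(v)$ for all $v$. The list chromatic number $\chi_\ell(G)$ is the smallest $k\ge 1$ such that $G$ has an $L$-coloring for every list assignment $L$ with $|L(v)|\ge k$ for all $v$. *)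

(* Defs.v *)
From mathcomp Require Import all_boot all_order all_algebra finmap.
From mathcomp Require Import boolp reals.

Set Implicit Arguments.
Unset Strict Implicit.
Unset Printing Implicit Defensive.

Record sgraph := SGraph {
  vertex :> finType;
  adj : rel vertex;
  adj_sym : symmetric adj;
  adj_irrefl : irreflexive adj }.

Definition induced_adj (G : sgraph) (Z : {set G}) : rel G :=
  [rel u v | [&& u \in Z, v \in Z & adj u v]].

(* Holds of the empty set; non-emptiness of branch sets is required in
   [has_complete_minor]. *)
Definition induced_connected (G : sgraph) (Z : {set G}) : Prop :=
  {in Z &, forall x y, connect (induced_adj Z) x y}.

(* The subgraph partitioned by the branch sets is the one on their union. *)
Definition has_complete_minor (t : nat) (G : sgraph) : Prop :=
  exists Z : 'I_t -> {set G},
    [/\ forall i, Z i != set0,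
        forall i j, i != j -> [disjoint Z i & Z j],
        forall i, induced_connected (Z i)
      & forall i j, i != j ->
          exists x y : G, [/\ x \in Z i, y \in Z j & adj x y]].

Definition list_assignment (G : sgraph) := G -> {fset nat}.

Definition proper_coloring (G : sgraph) (c : G -> nat) : Prop :=
  forall u v : G, adj u v -> c u <> c v.

Definition list_coloring (G : sgraph) (L : list_assignment G)
    (c : G -> nat) : Prop :=
  proper_coloring c /\ forall v : G, c v \in L v.

Definition choosable (G : sgraph) (k : nat) : Prop :=
  forall L : list_assignment G, (forall v : G, k <= #|` L v|) ->
    exists c : G -> nat, list_coloring L c.

Lemma choosable_card (G : sgraph) : choosable G #|G|.+1.
Proof.
move=> L HL.
have pick_inj (s : seq G) : uniq s -> exists c : G -> nat,
    {in s &, injective c} /\ {in s, forall v, c v \in L v}.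
  elim: s => [|x s IHs] /=; first by exists (fun=> 0).
  case/andP=> xs us; have [c [cI cL]] := IHs us.
  have [a aL aN] : exists2 a, a \in L x & a \notin map c s.
    apply/hasP; rewrite -[has _ _]negbK -all_predC; apply/negP => /allP H.
    have : #|` L x| <= size (map c s).
      apply: uniq_leq_size; first exact: fset_uniq.
      by move=> b /H /=; rewrite negbK.
    rewrite size_map leqNgt (leq_trans _ (HL x)) // ltnS.
    by rewrite -(card_uniqP us) max_card.
  exists (fun v => if v == x then a else c v); split => [u v|v].
    rewrite !inE; case: eqP => [-> _|_ /= us']; case: eqP => [-> //|_ /= vs'].
    - by move=> E; rewrite E map_f in aN.
    - by move=> _ E; rewrite -E map_f in aN.
    - exact: cI.
  by rewrite inE; case: eqP => [-> //|_ /= /cL].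
have [c [cI cL]] := pick_inj _ (enum_uniq G).
exists c; split => [u v uv E|v]; last by apply: cL; rewrite mem_enum.
have /cI euv : u \in enum G by rewrite mem_enum.
by move: uv; rewrite (euv v) ?mem_enum // adj_irrefl.
Qed.

Lemma choosable_exists (G : sgraph) :
  exists k : nat, (0 < k) && `[< choosable G k >].
Proof. by exists #|G|.+1; apply/asboolP; exact: choosable_card. Qed.

Definition list_chromatic_number (G : sgraph) : nat :=
  ex_minn (choosable_exists G).

Lemma list_chromatic_numberP (G : sgraph) :
  [/\ 0 < list_chromatic_number G, choosable G (list_chromatic_number G)
    & forall k, 0 < k -> choosable G k -> list_chromatic_number G <= k].
Proof.
rewrite /list_chromatic_number; case: ex_minnP => m /andP[m0 /asboolP mc] mm.
by split=> // k k0 kc; apply: mm; rewrite k0; apply/asboolP.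
Qed.

(* Main.v *)
Require Import Defs.
From mathcomp Require Import all_boot all_order all_algebra reals.
From mathcomp Require Import finmap zify lra.
Import Order.TTheory GRing.Theory Num.Theory.

(* Take two cliques [A] and [B] of size about [n] whose non-adjacency relation
   [F] is sparse, yet complete between some two members of any two large
   families of disjoint small subsets of [A] and of [B]. Such an [F] is a colour
   class of a map [A * B -> 'I_q]: a union bound over the families shows that for
   some map every colour class has the second property, and the rarest colour is
   sparse; vertices of [B] with many non-neighbours are then deleted.
   Glue to [A] one copy of [B] for every colouring of [A]. Choosing the lists in
   each copy to exclude the colours of the non-neighbours in [A] makes some copy
   need [#|A| + #|B|] colours. In a complete minor, the branch sets missing [A]
   all lie in a single copy of [B]; with at least [n + 2 * r] branch sets,
   at least [2 * r] of them miss [A] and [2 * r] miss that copy, so by the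
   property of [F] two of them are not adjacent. *)

Set Implicit Arguments.
Unset Strict Implicit.
Unset Printing Implicit Defensive.

Local Open Scope nat_scope.

(** * Counting maps that colour no given block entirely with [q0] *)

Lemma card_fibers_leq (T U : finType) (f : T -> U) (S : {set T}) (P : {set U})
    (m : nat) :
  {in S, forall x, f x \in P} ->
  (forall y, y \in P -> #|[set x in S | f x == y]| <= m) ->
  #|S| <= #|P| * m.
Proof.
move=> fP fm; rewrite -sum1_card (partition_big f (mem P)) //=.
rewrite -sum_nat_const; apply: leq_sum => y yP.
apply: leq_trans (fm y yP); rewrite -sum1_card.
by rewrite leq_eqVlt; apply/orP; left; apply/eqP/eq_bigl => x; rewrite inE.
Qed.

Section Avoidance.
Variables (T Q I : finType) (q0 : Q) (X : I -> {set T}) (m : nat).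
Hypothesis X_disj : forall i j, i != j -> [disjoint X i & X j].
Hypothesis X_card : forall i, #|X i| <= m.

Definition avoiding (s : seq I) : {set {ffun T -> Q}} :=
  [set f : {ffun T -> Q} | all (fun i => ~~ [forall x in X i, f x == q0]) s].

(** Recolour the block [X i] with [q0]: by disjointness the other blocks are untouched, so the
    result still avoids [s] but no longer [i]. Maps with the same image differ only on [X i], hence
    each fibre has at most [#|Q| ^ m] elements. *)
Lemma avoiding_cons (i : I) (s : seq I) : i \notin s ->
  #|avoiding s| <= #|avoiding s :\: avoiding (i :: s)| * #|Q| ^ m.
Proof.
move=> is'.
pose g (f : {ffun T -> Q}) := [ffun x => if x \in X i then q0 else f x].
apply: (@card_fibers_leq _ _ g) => [f|f _].
  rewrite !inE => fs; rewrite /= negb_and negbK; apply/andP; split.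
    by apply/orP; left; apply/forall_inP => x xi; rewrite ffunE xi.
  apply/allP => j js; have /allP/(_ j js) := fs.
  apply: contra => /forall_inP gj; apply/forall_inP => x xj.
  have ij : i != j by apply: contraNneq is' => ->.
  by have := gj x xj; rewrite ffunE (disjointFl (X_disj ij) xj).
have Q0 : 0 < #|Q| by apply/card_gt0P; exists q0.
apply: leq_trans (leq_pexp2l Q0 (X_card i)).
set S := [set _ in _ | _].
have -> : #|Q| ^ #|X i| = #|pffun_on q0 (mem (X i)) (mem Q)|.
  by rewrite card_pffun_on.
pose h (f' : {ffun T -> Q}) := [ffun x => if x \in X i then f' x else q0].
have h_inj : {in S &, injective h}.
  move=> f1 f2; rewrite !inE => /andP[_ /eqP g1] /andP[_ /eqP g2] hh.
  apply/ffunP => x; case xi: (x \in X i).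
    by have /ffunP/(_ x) := hh; rewrite !ffunE xi.
  have : g f1 = g f2 by rewrite g1 g2.
  by move=> /ffunP/(_ x); rewrite !ffunE xi.
rewrite -(card_in_imset h_inj); apply/subset_leq_card/subsetP => y.
move=> /imsetP[f' _ ->]; apply/pffun_onP; split => //.
  by apply/supportP => x xi; rewrite ffunE (negbTE xi).
Qed.

(** With [M = #|Q| ^ m], each further block keeps at most a fraction [1 - 1/M] of the maps, as
    independence would give. *)
Lemma card_avoiding (s : seq I) : uniq s ->
  #|avoiding s| * (#|Q| ^ m) ^ size s <= #|Q| ^ #|T| * (#|Q| ^ m).-1 ^ size s.
Proof.
elim: s => [_|i s IHs /= /andP[is' us]].
  by rewrite !expn0 !muln1 -card_ffun max_card.
have sub : avoiding (i :: s) \subset avoiding s.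
  by apply/subsetP => f; rewrite !inE /= => /andP[].
have := avoiding_cons is'; rewrite cardsD (setIidPr sub).
have := subset_leq_card sub; have := IHs us; rewrite !expnS.
move: (#|avoiding (i :: s)|) (#|avoiding s|) (#|Q| ^ m) (size s) => a b M l.
case: M => [|M] /= h1 h2 h3; first by rewrite mul0n muln0.
have aM : a * M.+1 <= b * M.
  have := subnK h2; move: (b - a) h3 => c h3 e; subst b; lia.
apply: (@leq_trans (b * M * M.+1 ^ l)); first by rewrite mulnA leq_mul2r aM orbT.
by rewrite mulnAC [_ * (M * _)]mulnCA [M * _]mulnC leq_mul2r h1 orbT.
Qed.

End Avoidance.

(** * Exponential against polynomial growth *)

Lemma bernoulli_expn (M h : nat) : h * M ^ h <= M * M.+1 ^ h.
Proof.
have : (M + h) * M ^ h <= M * M.+1 ^ h; last by nia.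
elim: h => [|h IH]; first by rewrite addn0.
rewrite !expnS; move: IH; move: (M ^ h) (M.+1 ^ h) => a b; nia.
Qed.

(** Cut [r] into [d.+1] blocks of length [h] and apply Bernoulli's inequality to each. The product
    gains a factor of order [r ^ d.+1], and the one spare power of [r] beats the constant. *)
Lemma exp_beats_poly (M C d : nat) :
  exists r0, forall r, r0 <= r -> C * r ^ d * M ^ r < M.+1 ^ r.
Proof.
pose K := (M * (2 * d.+1)) ^ d.+1.
exists (C * K + d.+1) => r hr.
pose h := r %/ d.+1.
have rh : r <= h * (2 * d.+1).
  have h0 : 0 < h by rewrite divn_gt0 // (leq_trans _ hr) // leq_addl.
  have := divn_eq r d.+1; have := ltn_pmod r (ltn0Sn d); rewrite -/h; nia.
have key : r ^ d.+1 * M ^ r <= K * M.+1 ^ r.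
  have e : r = h * d.+1 + r %% d.+1 by rewrite /h -divn_eq.
  apply: (@leq_trans ((h * (2 * d.+1)) ^ d.+1 * M ^ r)).
    by rewrite leq_mul2r leq_exp2r // rh orbT.
  rewrite [in M ^ r]e [in M.+1 ^ r]e !expnD !mulnA leq_mul //; last first.
    by case: (r %% d.+1) => // p; rewrite leq_exp2r.
  rewrite /K !expnM -!expnMn leq_exp2r //.
  by have := bernoulli_expn M h; nia.
have rpos : C * K < r by nia.
rewrite ltnNge; apply/negP => le.
have : r * M.+1 ^ r <= C * K * M.+1 ^ r.
  apply: (@leq_trans (C * (r ^ d.+1 * M ^ r))).
    by rewrite expnS; nia.
  by rewrite -mulnA leq_mul.
by rewrite leq_pmul2r ?expn_gt0 //; lia.
Qed.

(** * Sparse relations that fill a rectangle between any two families of small sets *)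

(* [F] stands for non-adjacency, so [X i] and [Y j] have no edge in between. *)
Definition unlinked (A B : finType) (F : A -> B -> bool) (r k : nat) : Prop :=
  forall (X : 'I_r -> {set A}) (Y : 'I_r -> {set B}),
    (forall i, 0 < #|X i| <= k) -> (forall i, 0 < #|Y i| <= k) ->
    (forall i j, i != j -> [disjoint X i & X j]) ->
    (forall i j, i != j -> [disjoint Y i & Y j]) ->
  exists i j, {in X i & Y j, forall a b, F a b}.

(** This bounds the number of families by [#|A| ^ (r * k)] for the union bound. *)
Lemma small_sets_parametrized (A : finType) (r k : nat) (X : 'I_r -> {set A}) :
  (forall i, 0 < #|X i| <= k) ->
  exists f : {ffun 'I_r * 'I_k -> A}, forall i, X i = [set f (i, u) | u : 'I_k].
Proof.
move=> hX.
have /fin_all_exists[g gP] : forall i, exists g : 'I_k -> A,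
    X i = [set g u | u : 'I_k].
  move=> i; have /andP[/card_gt0P[a0 a0X] Xk] := hX i.
  (* Non-emptiness supplies [a0], which pads the enumeration to length [k]. *)
  exists (fun u => if u < #|X i| then nth a0 (enum (X i)) u else a0).
  apply/setP => a; apply/idP/imsetP => [aX|[u _ ->]].
    have lt : index a (enum (X i)) < #|X i| by rewrite cardE index_mem mem_enum.
    exists (Ordinal (leq_trans lt Xk)) => //=.
    by rewrite lt nth_index // mem_enum.
  case: ifP => // lt; rewrite -mem_enum; apply: mem_nth.
  by rewrite -cardE.
exists [ffun p => g p.1 p.2] => i; rewrite gP.
by apply: eq_imset => u; rewrite ffunE.
Qed.

Lemma leq_card_bigcup (I T : finType) (S : I -> {set T}) :
  #|\bigcup_i S i| <= \sum_i #|S i|.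
Proof.
elim/big_rec2: _ => [|i n U _ IH]; first by rewrite cards0.
by apply: leq_trans (leq_add (leqnn _) IH); rewrite leq_card_setU.
Qed.

Lemma unlinked_exists (A B : finType) (r k q : nat) : 0 < q ->
  #|A| ^ (r * k) * #|B| ^ (r * k) * q * (q ^ (k * k)).-1 ^ (r * r)
    < (q ^ (k * k)) ^ (r * r) ->
  exists2 F : A -> B -> bool, unlinked F r k
    & q * #|[set p | F p.1 p.2]| <= #|A| * #|B|.
Proof.
move=> q0; set M := q ^ (k * k) => lt.
pose par := ({ffun 'I_r * 'I_k -> A} * {ffun 'I_r * 'I_k -> B} * 'I_q)%type.
pose XA (p : par) i := [set p.1.1 (i, u) | u : 'I_k].
pose XB (p : par) i := [set p.1.2 (i, u) | u : 'I_k].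
pose ok (p : par) := [forall i, forall j, (i != j) ==>
  ([disjoint XA p i & XA p j] && [disjoint XB p i & XB p j])].
pose rect (p : par) (ij : 'I_r * 'I_r) := setX (XA p ij.1) (XB p ij.2).
(* Only disjoint families give disjoint rectangles, which the avoidance bound needs; the other
   parameters get an empty event. *)
pose bad (p : par) : {set {ffun A * B -> 'I_q}} :=
  if ok p then avoiding p.2 (rect p) (enum {: 'I_r * 'I_r}) else set0.
have badle p : #|bad p| * M ^ (r * r) <= q ^ (#|A| * #|B|) * M.-1 ^ (r * r).
  rewrite /bad; case: ifP => [okp|_]; last by rewrite cards0.
  have := @card_avoiding (A * B)%type 'I_q ('I_r * 'I_r)%type p.2 (rect p)
    (k * k) _ _ (enum {: 'I_r * 'I_r}) (enum_uniq _).
  rewrite -cardE !card_prod !card_ord; apply => [[i i'] [j j'] neq|[i i']].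
    rewrite -setI_eq0; apply/eqP/setP => -[a b]; rewrite !inE /=.
    apply/negP => /andP[/andP[ai bi] /andP[aj bj]].
    move/forallP: okp => okp.
    case: (eqVneq i j) neq ai => [->|ij] neq ai.
      have ij' : i' != j' by apply: contraNneq neq => ->.
      have /forallP/(_ j')/implyP/(_ ij')/andP[_ d] := okp i'.
      by rewrite (disjointFr d bi) in bj.
    have /forallP/(_ j)/implyP/(_ ij)/andP[d _] := okp i.
    by rewrite (disjointFr d ai) in aj.
  rewrite cardsX; apply: leq_mul;
    by apply: leq_trans (leq_imset_card _ _) _; rewrite card_ord.
have [f fP] : exists f, f \notin \bigcup_p bad p.
  apply/existsP; rewrite -negb_forall; apply/negP => /forallP full.
  have M0 : 0 < M ^ (r * r) by rewrite !expn_gt0 q0.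
  have : #|\bigcup_p bad p| * M ^ (r * r) < q ^ (#|A| * #|B|) * M ^ (r * r).
    apply: (@leq_ltn_trans (\sum_(p : par) q ^ (#|A| * #|B|) * M.-1 ^ (r * r))).
      apply: leq_trans (leq_mul (leq_card_bigcup _) (leqnn _)) _.
      by rewrite big_distrl leq_sum.
    rewrite sum_nat_const !card_prod !card_ffun !card_prod !card_ord.
    by rewrite mulnCA ltn_pmul2l // expn_gt0 q0.
  rewrite ltn_pmul2r // ltnNge => /negP; apply.
  rewrite -[leqLHS](_ : #|{: {ffun A * B -> 'I_q}}| = _); last first.
    by rewrite card_ffun card_prod card_ord.
  by apply/subset_leq_card/subsetP => g _; apply: full.
(* The [q] colour classes partition [A * B], so the rarest one is at most average. *)
have /existsP[j jP] : [exists j : 'I_q,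
    q * #|[set p | f p == j]| <= #|A| * #|B|].
  apply: contraT => /existsPn all_big.
  have : \sum_(j < q) (#|A| * #|B|).+1 <= \sum_(j < q) q * #|[set p | f p == j]|.
    by apply: leq_sum => j _; rewrite ltnNge all_big.
  rewrite -big_distrr /= sum_nat_const card_ord leq_pmul2l //.
  suff -> : \sum_(j < q) #|[set p | f p == j]| = #|A| * #|B| by rewrite ltnn.
  rewrite -card_prod -sum1_card (partition_big f predT) //=.
  by apply: eq_bigr => j _; rewrite -sum1_card; apply: eq_bigl => p; rewrite inE.
exists (fun a b => f (a, b) == j); last first.
  by move: jP; congr (_ * #|pred_of_set _| <= _); apply/setP => -[a b]; rewrite !inE.
move=> X Y hX hY dX dY.
have [phi phiP] := small_sets_parametrized hX.
have [psi psiP] := small_sets_parametrized hY.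
pose p : par := (phi, psi, j).
have okp : ok p.
  apply/forallP => i; apply/forallP => i'; apply/implyP => ii'.
  by rewrite /XA /XB -!phiP -!psiP dX // dY.
have : f \notin bad p by apply: contra fP => fp; apply/bigcupP; exists p.
rewrite /bad okp inE => /allPn[[i i'] _]; rewrite negbK => /forall_inP h.
exists i, i' => a b aX bY; apply: h.
by rewrite inE /= /XA /XB -phiP -psiP aX.
Qed.

(** With [q = k * k] colours, an average class of the [(k * r) ^ 2] pairs has [r * r] elements. *)
Lemma unlinked_few_edges (k : nat) : 0 < k ->
  exists r0, forall r, r0 <= r ->
    exists2 F : 'I_(k * r) -> 'I_(k * r) -> bool, unlinked F r k
      & #|[set p | F p.1 p.2]| <= r * r.
Proof.
move=> k0; have [q qE] : exists q, q = k * k by exists (k * k).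
have q0 : 0 < q by rewrite qE muln_gt0 k0.
pose M := q ^ (k * k).
have M0 : 0 < M by rewrite expn_gt0 q0.
(* These constants come from the [r]-th root of the union bound, with the factor [q] enlarged to
   [q ^ r]; this needs [r > 0], hence [r0.+1] below. *)
have [r0 hr0] := exp_beats_poly M.-1 (k ^ (2 * k) * q) (2 * k).
exists r0.+1 => r ltr.
have [|F F1 F2] := @unlinked_exists 'I_(k * r) 'I_(k * r) r k q q0.
  rewrite -/M !card_ord.
  have := hr0 r (ltnW ltr); rewrite prednK // -(@ltn_exp2r _ _ r); last lia.
  rewrite -[(M ^ r) ^ r]expnM; apply: leq_ltn_trans; rewrite -expnD -!mulnA.
  rewrite (mulnCA q) (mulnA (k ^ _)) -expnMn [leqRHS]expnMn -expnM.
  have -> : 2 * k * r = r * k + r * k by lia.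
  rewrite leq_mul2l; apply/orP; right.
  rewrite expnMn -expnM leq_mul2r; apply/orP; right.
  by rewrite -[leqLHS]expn1 leq_pexp2l //; lia.
exists F => //; move: F2; rewrite !card_ord qE.
by rewrite mulnACA leq_pmul2l // muln_gt0 k0.
Qed.

Lemma unlinked_restrict (A B : finType) (P : pred B) (F : A -> B -> bool)
    (r k : nat) :
  unlinked F r k -> unlinked (fun a (b : {b | P b}) => F a (val b)) r k.
Proof.
move=> uF X Y hX hY dX dY.
have [||i [j ij]] := uF X (fun i => [set val b | b in Y i]) hX _ dX _.
- by move=> i; rewrite card_imset //; apply: val_inj.
- by move=> i j /dY dij; rewrite imset_disjoint //; apply: val_inj.
by exists i, j => a b aX bY; apply: ij => //; apply: imset_f.
Qed.

(** Double counting: [r.+1] vertices with more than [r] non-neighbours each would already give more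
    than [r * r] pairs. *)
Lemma card_low_degree (A B : finType) (F : A -> B -> bool) (r : nat) :
  #|[set p | F p.1 p.2]| <= r * r ->
  #|B| <= #|[pred b | #|[set a | F a b]| <= r]| + r.
Proof.
move=> few; rewrite -(cardC [pred b | #|[set a | F a b]| <= r]) leq_add2l.
set high := predC _.
have : #|high| * r.+1 <= #|[set p | F p.1 p.2]|.
  rewrite -sum_nat_const -sum1_card.
  rewrite (partition_big snd predT) //= [leqRHS](bigID (mem high)) /=.
  apply: leq_trans (leq_addr _ _); apply: leq_sum => b.
  rewrite inE /= -ltnNge => /leq_trans-> //.
  rewrite -(card_imset _ (_ : injective (fun a => (a, b)))); last by move=> ? ? [].
  rewrite sum1_card; apply: subset_leq_card; apply/subsetP => -[a b'].
  by move/imsetP => [a' +] [-> ->]; rewrite !inE /= unfold_in /= inE /= eqxx => ->.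
nia.
Qed.

(** * The glued graph and its list colourings *)

Section GluedCliques.
Variables (A B : finType) (F : A -> B -> bool) (N : nat).

(* One copy of [B] for each assignment of [N] colours to [A]. *)
Let vert := (A + {ffun A -> 'I_N} * B)%type.

Definition glued_adj : rel vert := fun u v =>
  match u, v with
  | inl a, inl a' => a != a'
  | inl a, inr (_, b) => ~~ F a b
  | inr (_, b), inl a => ~~ F a b
  | inr (c, b), inr (c', b') => (c == c') && (b != b')
  end.

Lemma glued_adj_sym : symmetric glued_adj.
Proof.
by move=> [a|[c b]] [a'|[c' b']] //=; rewrite eq_sym // [b == _]eq_sym.
Qed.

Lemma glued_adj_irrefl : irreflexive glued_adj.
Proof. by move=> [a|[c b]] /=; rewrite !eqxx. Qed.

Definition glued := SGraph glued_adj_sym glued_adj_irrefl.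

(* A list colouring restricts to some [c] on [A]; in the copy of [B] indexed by
   [c] the lists exclude the colours of the non-neighbours, so no colour of
   [A] can be reused there. *)
Lemma glued_not_choosable (d : nat) :
  (forall b, #|[set a | F a b]| <= d) -> N < #|A| + #|B| ->
  ~ choosable glued (N - d).
Proof.
move=> Fd NAB.
pose allowed (v : vert) (x : nat) := match v with
  | inl _ => true
  | inr (c, b) => x \notin [seq val (c a) | a <- enum [set a | F a b]] end.
pose L (v : glued) : {fset nat} := seq_fset tt [seq x <- iota 0 N | allowed v x].
have memL v x : (x \in L v) = (x < N) && allowed v x.
  by rewrite seq_fsetE mem_filter mem_iota add0n andbC.
case/(_ L) => [v|col [proper colL]].
  rewrite /L size_seq_fset undup_id ?filter_uniq ?iota_uniq // size_filter.
  rewrite leq_subLR -[leqLHS](size_iota 0) -(count_predC (allowed v)) addnC.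
  rewrite leq_add2r.
  case: v => [a|[c b]] /=; first by rewrite (eq_count (a2 := pred0)) ?count_pred0.
  apply: leq_trans (Fd b); rewrite cardE -(size_map (fun a => val (c a))).
  rewrite -size_filter; apply: uniq_leq_size; first by rewrite filter_uniq ?iota_uniq.
  by move=> x; rewrite mem_filter /= negbK => /andP[].
have colN v : col v < N by have := colL v; rewrite memL => /andP[].
pose c := [ffun a => Ordinal (colN (inl a))].
(* On [A] and copy [c] all colours differ: within each clique by properness, across by adjacency or
   by the lists. So [#|A| + #|B|] colours fit into [N], a contradiction. *)
pose g (u : A + B) := match u with
  | inl a => Ordinal (colN (inl a)) | inr b => Ordinal (colN (inr (c, b))) end.
have cross a b : col (inl a) <> col (inr (c, b)).
  case Fab: (F a b); last by apply: proper; rewrite /= Fab.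
  have := colL (inr (c, b)); rewrite memL /= => /andP[_ /mapP nex] e.
  by apply: nex; exists a; rewrite ?mem_enum ?inE // ffunE.
have g_inj : injective g.
  move=> [a|b] [a'|b'] /(congr1 val) /= e.
  - by case: (eqVneq a a') => [->//|ne]; case: (proper (inl a) (inl a') ne).
  - by case: (cross _ _ e).
  - by case: (cross _ _ (esym e)).
  - case: (eqVneq b b') => [->//|ne].
    by case: (proper (inr (c, b)) (inr (c, b'))) => //=; rewrite eqxx.
by have := leq_card g g_inj; rewrite card_sum card_ord leqNgt NAB.
Qed.

End GluedCliques.

(** * Complete minors in the glued graph *)

Lemma disjoint_sets_card (I T : finType) (P : pred I) (S : I -> {set T}) (m : nat) :
  (forall i j, i != j -> [disjoint S i & S j]) ->
  (forall i, P i -> m <= #|S i|) -> #|P| * m <= #|T|.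
Proof.
move=> dS hS; rewrite -sum_nat_const.
apply: (@leq_trans (\sum_(i in P) #|S i|)); first exact: leq_sum.
apply: (@leq_trans (\sum_i #|S i|)).
  by rewrite [leqRHS](bigID (mem P)) leq_addr.
have <- : #|\bigcup_i S i| = \sum_i #|S i|.
  rewrite -sum1_card partition_disjoint_bigcup //=.
  by apply: eq_bigr => i _; rewrite sum1_card.
exact: max_card.
Qed.

Lemma many_empty_sets (t : nat) (T : finType) (S : 'I_t -> {set T}) (m : nat) :
  (forall i j, i != j -> [disjoint S i & S j]) ->
  #|T| + m <= t -> m <= #|[pred i | S i == set0]|.
Proof.
move=> dS le; set E := [pred i | _].
rewrite -(leq_add2r #|[predC E]|) cardC card_ord; apply: leq_trans le.
rewrite addnC leq_add2r.
rewrite -[leqLHS]muln1; apply: disjoint_sets_card dS _ => i.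
by rewrite card_gt0.
Qed.

(** At most [r] of the disjoint sets can have more than [k] elements, which leaves [r] of the
    [2 * r] indices. *)
Lemma many_small_sets (t : nat) (T : finType) (P : pred 'I_t)
    (S : 'I_t -> {set T}) (r k : nat) :
  (forall i j, i != j -> [disjoint S i & S j]) ->
  #|T| <= k * r -> 2 * r <= #|P| ->
  exists f : 'I_r -> 'I_t,
    injective f /\ forall i, P (f i) /\ #|S (f i)| <= k.
Proof.
move=> dS Tkr Pr; pose Q := [pred i | P i & #|S i| <= k].
have rQ : r <= #|Q|.
  have : #|[pred i | P i & k < #|S i|]| * k.+1 <= k * r.
    by apply: leq_trans Tkr; apply: disjoint_sets_card dS _ => i /andP[].
  have : #|P| <= #|Q| + #|[pred i | P i & k < #|S i|]|.
    rewrite -(cardID [pred i | #|S i| <= k] P) leq_add //.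
    apply/subset_leq_card/subsetP => i /andP[h1 h2]; apply/andP.
    by rewrite ltnNge.
  nia.
exists (fun i => enum_val (widen_ord rQ i)); split.
  by move=> i j /enum_val_inj /(congr1 val) /= /val_inj.
by move=> i; have /andP[] := enum_valP (widen_ord rQ i).
Qed.

Section NoMinor.
Variables (A B : finType) (F : A -> B -> bool) (N r k t : nat).
Hypothesis uF : unlinked F r k.
Hypothesis Ak : #|A| <= k * r.
Hypothesis Bk : #|B| <= k * r.
Hypothesis At : #|A| + 2 * r <= t.
Hypothesis Bt : #|B| + 2 * r <= t.
Hypothesis r0 : 0 < r.

Definition in_copy (c : {ffun A -> 'I_N}) : pred (glued F N) :=
  fun v => if v is inr (c', _) then c' == c else false.

(** Edges between vertices outside [A] never leave a copy, so a path avoiding [A] stays in its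
    copy. *)
Lemma connected_in_copy (c : {ffun A -> 'I_N}) (Z : {set glued F N}) v w :
  induced_connected Z -> (forall a, inl a \notin Z) ->
  v \in Z -> in_copy c v -> w \in Z -> in_copy c w.
Proof.
move=> Zc ZA vZ cv wZ.
have cl : fingraph.closed (induced_adj Z) (in_copy c).
  move=> [a|[c1 b1]] [a'|[c2 b2]] /and3P[h1 h2] //=.
  - by case/negP: (ZA a).
  - by case/negP: (ZA a').
  - by case/andP => /eqP ->.
have e : in_copy c v = in_copy c w := closed_connect cl (Zc v w vZ wZ).
by rewrite -e.
Qed.

Lemma glued_no_minor : ~ has_complete_minor t (glued F N).
Proof.
case=> Z [Z0 Zd Zc Za].
pose ZA i := [set a | inl a \in Z i].
pose missA : pred 'I_t := [pred i | ZA i == set0].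
have dA i j : i != j -> [disjoint ZA i & ZA j].
  move=> /Zd d; rewrite -setI_eq0; apply/eqP/setP => a; rewrite !inE.
  by apply/negP => /andP[h]; rewrite (disjointFr d h).
have cA : 2 * r <= #|missA| by apply: many_empty_sets.
have missAP i a : missA i -> inl a \notin Z i.
  by move=> /eqP/setP/(_ a); rewrite !inE => ->.
have [i0 i0A] : exists i, missA i.
  by apply/card_gt0P; apply: leq_trans cA; rewrite muln_gt0.
have [v0 v0Z] := set0Pn _ (Z0 i0).
have [c cv0] : exists c, in_copy c v0.
  case: v0 v0Z => [a h|[c b] _]; last by exists c => /=.
  by case/negP: (missAP i0 a i0A).
(* The copy met by [Z i0] serves for all: an edge joins [Z i0] to any other branch set missing [A],
   and such an edge stays within one copy. *)
have copy i v : missA i -> v \in Z i -> in_copy c v.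
  move=> iA vZ; case: (eqVneq i0 i) => [e|ne].
    by apply: (connected_in_copy (Zc i)) vZ; rewrite -?e; eauto.
  have [x [y [xZ yZ xy]]] := Za _ _ ne.
  apply: (connected_in_copy (Zc i) _ yZ _ vZ); first by move=> a; apply: missAP.
  have : in_copy c x.
    by apply: (connected_in_copy (Zc i0) _ v0Z cv0 xZ) => a; apply: missAP.
  case: y x yZ xZ xy => [a|[c2 b2]] [a'|[c1 b1]] //=.
    by move=> h; case/negP: (missAP i a iA).
  by move=> _ _ /andP[/eqP ->].
pose ZB i := [set b | inr (c, b) \in Z i].
pose missB : pred 'I_t := [pred i | ZB i == set0].
have dB i j : i != j -> [disjoint ZB i & ZB j].
  move=> /Zd d; rewrite -setI_eq0; apply/eqP/setP => b; rewrite !inE.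
  by apply/negP => /andP[h]; rewrite (disjointFr d h).
have cB : 2 * r <= #|missB| by apply: many_empty_sets.
have missA_B i : missA i -> ZB i != set0.
  move=> iA; have [v vZ] := set0Pn _ (Z0 i); apply/set0Pn.
  by case: v vZ (copy i v iA vZ) => [a|[c' b]] //= vZ /eqP e; exists b; rewrite inE -e.
have missB_A i : missB i -> ZA i != set0.
  by move=> iB; apply/negP => /missA_B; rewrite (eqP iB) eqxx.
have [f [f_inj fP]] := many_small_sets dA Ak cB.
have [g [g_inj gP]] := many_small_sets dB Bk cA.
have [||||i [j ij]] := uF (X := ZA \o f) (Y := ZB \o g).
- by move=> i; rewrite card_gt0 missB_A; case: (fP i).
- by move=> i; rewrite card_gt0 missA_B; case: (gP i).
- by move=> i j ij; apply: dA; rewrite (inj_eq f_inj).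
- by move=> i j ij; apply: dB; rewrite (inj_eq g_inj).
have [fB _] := fP i; have [gA _] := gP j.
have ne : f i != g j.
  by apply: contraNneq (missB_A _ fB) => ->.
(* Here [y] lies in copy [c]. Its neighbour [x] cannot be in [A], where [F] holds throughout, nor in
   copy [c], which [Z (f i)] misses, nor in another copy. *)
have [x [y [xZ yZ]]] := Za _ _ ne.
have := copy _ _ gA yZ; case: y yZ => [//|[c' b]] /= + /eqP e; rewrite {}e => bZ.
case: x xZ => [a|[c1 b1]] xZ /=.
  by rewrite (ij a b) //= inE.
case/andP => /eqP e _; have /eqP/setP/(_ b1) := fB.
by rewrite !inE -e xZ.
Qed.

End NoMinor.

(** * Choice of parameters *)

Lemma not_choosable_lt (G : sgraph) (m : nat) :
  ~ choosable G m -> m < list_chromatic_number G.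
Proof.
move=> nc; rewrite ltnNge; apply/negP => le; apply: nc => L hL.
have [_ ch _] := list_chromatic_numberP G.
by apply: ch => v; apply: leq_trans (hL v).
Qed.

Lemma no_minor_not_choosable (k : nat) : 0 < k ->
  exists r0, forall r, r0 <= r -> forall t, (k + 2) * r <= t ->
    exists G : sgraph, ~ has_complete_minor t G
      /\ (2 * k - 2) * r <= list_chromatic_number G.
Proof.
move=> k0; have [r0 hr0] := unlinked_few_edges k0.
exists r0.+1 => r ltr t let_t.
have [F uF few] := hr0 r (ltnW ltr).
have r_gt0 : 0 < r by lia.
pose P := [pred b | #|[set a | F a b]| <= r].
pose F' a (b : {b | P b}) := F a (val b).
have Ble : #|{: {b | P b}}| <= k * r.
  by rewrite card_sig (leq_trans (max_card _)) // card_ord.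
have Bge : k * r <= #|{: {b | P b}}| + r.
  by have := card_low_degree few; rewrite card_ord card_sig.
have kr : 0 < k * r by rewrite muln_gt0 k0.
have [m mE] : exists m, #|{: {b | P b}}| = m by exists #|{: {b | P b}}|.
rewrite mE in Ble Bge.
(* The palette is one colour short of the [k * r + m] vertices of [A] and one copy of [B]. Deleting
   vertices of [B] and shortening the lists each cost at most [r], whence [2 * k - 2]. *)
exists (glued F' (k * r + m).-1); split.
  apply: (@glued_no_minor _ _ _ _ r k) => //; rewrite ?card_ord ?mE //.
  - exact: unlinked_restrict.
  - by lia.
  - by lia.
have : ~ choosable (glued F' (k * r + m).-1) ((k * r + m).-1 - r).
  by apply: glued_not_choosable => [b|]; [exact: (valP b)|rewrite card_ord mE; lia].
by move/not_choosable_lt; apply: leq_trans; lia.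
Qed.

Local Open Scope ring_scope.

Theorem theorem2 (R : realType) (eps : R) (heps0 : 0 < eps) (heps1 : eps < 1) :
  exists t0 : nat, forall t : nat, (t0 <= t)%N ->
    exists G : sgraph,
      ~ has_complete_minor t G /\
      (2 - eps) * t%:R <= (list_chromatic_number G)%:R.
Proof.
(* The bound [6 <= eps * k] is exactly what [(2 - eps) * (k + 2) <= 2 * k - 2 - 2 * eps]
   requires. *)
pose k := Num.bound (6 / eps).
have hk : 6 <= eps * k%:R.
  by rewrite mulrC -ler_pdivrMr // ltW // archi_boundP // divr_ge0 // ltW.
have k0 : (0 < k)%N by case: k hk => //; rewrite mulr0; lra.
have [r0 hr0] := no_minor_not_choosable k0.
(* Having [k <= eps * r] absorbs the loss from rounding [t] up to [(k + 2) * r.+1]. *)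
pose r1 := Num.bound (k%:R / eps).
exists ((k + 2) * (r0 + r1))%N => t le_t.
pose r := (t %/ (k + 2))%N.
have le_r : (r0 + r1 <= r)%N by rewrite leq_divRL ?addn2 // mulnC -addn2.
have hr : k%:R <= eps * r%:R :> R.
  rewrite mulrC -ler_pdivrMr //; apply: (@le_trans _ _ r1%:R).
    by rewrite ltW // archi_boundP // divr_ge0 // ltW.
  by rewrite ler_nat; lia.
have t_ge : ((k + 2) * r <= t)%N by rewrite mulnC leq_divM.
have t_le : (t <= (k + 2) * r.+1)%N by rewrite mulnC ltnW // ltn_ceil // addn2.
have [|G [noG chiG]] := hr0 r _ t t_ge; first lia.
exists G; split => //.
apply: (@le_trans _ _ ((2 * k - 2) * r)%N%:R); last by rewrite ler_nat.
rewrite natrM natrB ?natrM; last by lia.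
have {}t_le : t%:R <= (k%:R + 2) * (r%:R + 1) :> R.
  by rewrite -natrD natr1 -natrM ler_nat.
apply: (@le_trans _ _ ((2 - eps) * ((k%:R + 2) * (r%:R + 1)))).
  by rewrite ler_pM2l //; lra.
have r_ge0 : 0 <= r%:R :> R by [].
have : (2 - eps) * (k%:R + 2) <= 2 * k%:R - 2 - 2 * eps by lra.
rewrite -(ler_pM2r (_ : 0 < r%:R + 1 :> R)); last by lra.
rewrite mulrA => /le_trans; apply; nra.
Qed.
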